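(* Let $X$ and $Y$ be countable sets equipped with functions (heights) $H_1\colon X\to\mathbb{R}_{>0}$ and $H_2\colon Y\to\mathbb{R}_{>0}$. Put $N_X(B):=\#\{x\in X\mid H_1(x)\le B\}$ and $N_Y(B):=\#\{y\in Y\mid H_2(y)\le B\}$, and suppose that \[ N_X(B)\asymp B^{\alpha_1}(\log B)^{\beta_1},\qquad N_Y(B)\asymp B^{\alpha_2}(\log B)^{\beta_2}, \] where $\alpha_1\ge\alpha_2>0$ are real numbers and $\beta_1,\beta_2\in\mathbb{Z}_{\ge0}$. Define $(\alpha,\beta):=(\alpha_1,\beta_1)$ if $\alpha_1>\alpha_2$, and $(\alpha,\beta):=(\alpha_1,\beta_1+\beta_2+1)$ if $\alpha_1=\alpha_2$. Then \[ N_{X\times Y}(B):=\#\{(x,y)\in X\times Y\mid H_1(x)H_2(y)\le B\}\asymp B^{\alpha}(\log B)^{\beta}. \]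
   Context: For functions $f,g$ of a real variable $B$ with $g>0$ for large $B$, the notation $f(B)\asymp g(B)$ means that there are constants $c,C>0$ and $B_0$ such that $c\,g(B)\le f(B)\le C\,g(B)$ for all $B\ge B_0$ (as $B\to\infty$). *)

(* Defs.v *)
From mathcomp Require Import all_boot all_order all_algebra.
From mathcomp Require Import all_classical all_reals all_analysis.

Set Implicit Arguments.
Unset Strict Implicit.
Unset Printing Implicit Defensive.

Import Order.TTheory GRing.Theory Num.Theory.

Local Open Scope classical_set_scope.
Local Open Scope ring_scope.

(* The cardinality is [+oo] when infinitely many points have height at most
   [B]; no finiteness is presupposed. *)
Definition height_count (R : realType) (T : choiceType) (H : T -> R) (B : R)
    : \bar R :=
  counting [set x | H x <= B].

(* [f] is extended-real valued because it is a count: the upper bound forces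
   [f B] to be finite for every [B >= B0]. *)
Definition asymp (R : realType) (f : R -> \bar R) (g : R -> R) : Prop :=
  exists c C B0 : R,
    [/\ 0 < c, 0 < C &
      forall B, B0 <= B -> ((c * g B)%:E <= f B <= (C * g B)%:E)%E].

Definition pow_log (R : realType) (a : R) (b : nat) (B : R) : R :=
  B `^ a * ln B ^+ b.

Definition prod_height (R : realType) (X Y : Type) (H1 : X -> R) (H2 : Y -> R)
    (p : X * Y) : R :=
  H1 p.1 * H2 p.2.

(* Main.v *)
Require Import Defs.
From mathcomp Require Import all_boot all_order all_algebra.
From mathcomp Require Import all_classical all_reals all_analysis.
From mathcomp Require Import ring lra.

(** Pass to the log-heights [h = ln o H]: the product height becomes the sum
    [h1 x + h2 y], and [N(B)] becomes the number of points with [h <= t], where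
    [t = ln B], of order [exp (a t) t^b].

    Upper bound: heights are bounded below, so cutting [X] into unit shells
    [k <= h1 < k + 1] bounds the count by the convolution of the two growth
    functions.  When [a1 = a2] it has about [t] terms, each at most of order
    [exp (a t) t^(b1 + b2)]; when [a1 > a2] it is dominated by a geometric
    series.

    Lower bound: when [a1 > a2] a single [y] suffices.  When [a1 = a2 = a],
    choose a width [M] so large that [exp (a M)] beats the ratio of the two
    constants for [X]; each shell [k M < h1 <= (k + 1) M] then contains a
    positive proportion of the points with [h1 <= (k + 1) M].  The roughly
    [t / (3 M)] shells between [t / 3] and [2 t / 3] each contribute about
    [exp (a t) t^(b1 + b2)]. *)

Set Implicit Arguments.
Unset Strict Implicit.
Unset Printing Implicit Defensive.

Import Order.TTheory GRing.Theory Num.Theory.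

Local Open Scope ring_scope.

(** * Counting by finite lists, and the passage to logarithmic heights *)

Lemma counting_finite (R : realType) (T : choiceType) (A : set T) (r : R) :
  (counting A <= r%:E)%E ->
  exists s : seq T, [/\ uniq s, forall x, x \in s <-> A x &
    counting A = (size s)%:R%:E :> \bar R].
Proof.
rewrite /counting; case: asboolP => [finA _|_]; last by rewrite leye_eq.
exists (finmap.enum_fset (fset_set A)); split => //.
by move=> x; rewrite (in_fset_set finA); split=> [/set_mem|/mem_set].
Qed.

Lemma counting_le_size (R : realType) (T : choiceType) (A : set T)
    (s : seq T) :
  (forall x, A x -> x \in s) -> (counting A <= ((size s)%:R : R)%:E)%E.
Proof.
move=> As; have finA : finite_set A.
  by apply: (@sub_finite_set _ A [set` s]); [exact: As|exact: finite_seq].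
rewrite /counting asboolT// lee_fin ler_nat.
apply: uniq_leq_size; first exact: finmap.fset_uniq.
by move=> x; rewrite in_fset_set// => /set_mem/As.
Qed.

Lemma size_le_counting (R : realType) (T : choiceType) (A : set T)
    (s : seq T) :
  uniq s -> {in s, forall x, A x} -> (((size s)%:R : R)%:E <= counting A)%E.
Proof.
move=> us sA; rewrite /counting; case: asboolP => [finA|_]; last exact: leey.
rewrite lee_fin ler_nat; apply: uniq_leq_size => // x xs.
by rewrite in_fset_set//; apply/mem_set/sA.
Qed.

(* Counts are expressed by duplicate-free lists inside (lower bounds) and
   covering lists (upper bounds), so no finiteness has to be carried along. *)
Definition log_lower (R : realType) (T : eqType) (h : T -> R) (a : R)
    (b : nat) : Prop :=
  exists c t0 : R, 0 < c /\ forall t, t0 <= t -> exists s : seq T,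
    [/\ uniq s, {in s, forall x, h x <= t} &
      c * (expR (a * t) * t ^+ b) <= (size s)%:R].

Definition log_upper (R : realType) (T : eqType) (h : T -> R) (a : R)
    (b : nat) : Prop :=
  exists C t0 : R, 0 < C /\ forall t, t0 <= t -> exists2 s : seq T,
    forall x, h x <= t -> x \in s &
    (size s)%:R <= C * (expR (a * t) * t ^+ b).

(** The substitution [B = expR t] turns the comparison function into [expR (a * t) * t ^+ b]; as [H]
    is positive, [H x <= expR t] amounts to [ln (H x) <= t]. *)
Lemma asymp_pow_logP (R : realType) (T : choiceType) (H : T -> R) (a : R)
    (b : nat) : (forall x, 0 < H x) ->
  asymp (height_count H) (pow_log a b) <->
  log_lower (fun x => ln (H x)) a b /\ log_upper (fun x => ln (H x)) a b.
Proof.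
move=> H0.
have pe t : pow_log a b (expR t) = expR (a * t) * t ^+ b.
  by rewrite /pow_log /powR gt_eqF ?expR_gt0// expRK.
have he x t : (ln (H x) <= t) = (H x <= expR t).
  by rewrite -{1}(expRK t) ler_ln// posrE ?expR_gt0.
split=> [[c [C [B0 [c0 C0 HB]]]]|].
  (* [B0] may be nonpositive; the maximum with 1 is inverted correctly by [expR] after [ln]. *)
  have Ht t : ln (Num.max 1 B0) <= t -> B0 <= expR t.
    move=> ht; apply: (@le_trans _ _ (Num.max 1 B0)).
      by rewrite le_max lexx orbT.
    have m0 : 0 < Num.max 1 B0 by rewrite lt_max ltr01.
    by rewrite -(lnK m0) ler_expR.
  split.
    exists c, (ln (Num.max 1 B0)); split => // t /Ht /HB /andP[lo up].
    have [s [us sA es]] := counting_finite up.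
    exists s; split => //; first by move=> x /sA /=; rewrite he.
    by move: lo; rewrite /height_count es lee_fin pe.
  exists C, (ln (Num.max 1 B0)); split => // t /Ht /HB /andP[lo up].
  have [s [us sA es]] := counting_finite up.
  exists s; first by move=> x; rewrite he => /sA.
  by move: up; rewrite /height_count es lee_fin pe.
move=> [[c [t1 [c0 lo]]] [C [t2 [C0 up]]]].
exists c, C, (expR (Num.max t1 t2)); split => // B hB.
have B0 : 0 < B by apply: lt_le_trans hB; exact: expR_gt0.
have : Num.max t1 t2 <= ln B by rewrite -(ler_expR) (lnK B0).
move: (ln B) (lnK B0) => t <-; rewrite pe.
rewrite ge_max => /andP[/lo[s [us sA ls]] /up[s' As' ls']].
apply/andP; split.
  apply: le_trans (size_le_counting _ us _); first by rewrite lee_fin.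
  by move=> x /sA /=; rewrite he.
apply: le_trans (counting_le_size _ _) _; last by rewrite lee_fin; exact: ls'.
by move=> x /=; rewrite -he => /As'.
Qed.

(** Provides the single point of [Y] used when [alpha2 < alpha1]: at a positive [t] the lower bound
    is positive, so the list is nonempty. *)
Lemma log_lower_inhabited (R : realType) (T : eqType) (h : T -> R) (a : R)
    (b : nat) : log_lower h a b -> exists x : T, True.
Proof.
move=> [c [t0 [c0 lo]]].
have [|s [_ _]] := lo (Num.max 1 t0); first by rewrite le_max lexx orbT.
case: s => [|x s _]; last by exists x.
have m0 : 0 < Num.max 1 t0 by rewrite lt_max ltr01.
by rewrite leNgt !mulr_gt0 ?exprn_gt0 ?expR_gt0.
Qed.

Lemma seq_lower_bound (R : realType) (T : eqType) (h : T -> R) (r : R)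
    (s : seq T) : exists2 m, m <= r & {in s, forall x, m <= h x}.
Proof.
elim: s => [|y s [m mr IH]]; first by exists r.
exists (Num.min m (h y)); first by rewrite ge_min mr.
move=> x; rewrite inE => /orP[/eqP->|/IH hx]; first by rewrite ge_min lexx orbT.
by rewrite ge_min hx.
Qed.

(* The normalisation [h >= - m] with [m >= 0] makes the upper bound valid for
   all [t >= 0], not just for large [t]. *)
Lemma log_upper_uniform (R : realType) (T : eqType) (h : T -> R) (a : R)
    (b : nat) : 0 <= a -> log_upper h a b ->
  exists m C : R, [/\ 0 <= m, 0 < C, forall x, - m <= h x &
    forall t, 0 <= t -> exists2 s : seq T,
      forall x, h x <= t - m -> x \in s &
      (size s)%:R <= C * (expR (a * t) * (1 + t) ^+ b)].
Proof.
move=> a0 [C [t0 [C0 up]]].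
pose t1 := Num.max 0 t0.
have t10 : 0 <= t1 by rewrite le_max lexx.
have [|s1 hs1 _] := up t1; first by rewrite le_max lexx orbT.
(* Points outside [s1] have [h > t1 >= 0], so a bound [m <= 0] for [h] on [s1] holds everywhere. The
   witness given below is [- m]. *)
have [m m0 hm] := seq_lower_bound h 0 s1.
exists (- m), (C + (size s1)%:R); split; first lra.
- by rewrite ltr_wpDr ?ler0n.
- move=> x; rewrite opprK; have [/hs1/hm//|] := leP (h x) t1; lra.
move=> t t_ge0; rewrite opprK.
have e1 : 1 <= expR (a * t) by rewrite -expR0 ler_expR mulr_ge0.
have e2 : 1 <= (1 + t) ^+ b by apply: exprn_ege1; lra.
have [tt|tt] := leP t1 (t + m).
  have [|s hs ss] := up (t + m).
    by apply: le_trans tt; rewrite le_max lexx orbT.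
  exists s => //; apply: (le_trans ss); apply: ler_pM.
  - exact: ltW.
  - by rewrite mulr_ge0 ?expR_ge0 ?exprn_ge0//; apply: le_trans tt.
  - by rewrite lerDl.
  apply: ler_pM; rewrite ?expR_ge0 ?exprn_ge0 ?(le_trans t10)//.
    by rewrite ler_expR ler_wpM2l//; lra.
  by apply: lerXn2r; rewrite ?nnegrE; lra.
(* In this bounded range [s1] covers; the growth function is at least 1, so the summand
   [(size s1)%:R] of the constant suffices. *)
exists s1 => [x hx|]; first by apply: hs1; lra.
have : 1 <= expR (a * t) * (1 + t) ^+ b by rewrite -[leLHS]mulr1 ler_pM.
have : 0 <= (size s1)%:R :> R by rewrite ler0n.
nra.
Qed.

(** * Lower bounds for sums of log-heights *)

Lemma log_lower_shell (R : realType) (T : eqType) (h : T -> R) (a : R)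
    (b : nat) : 0 < a -> log_lower h a b -> log_upper h a b ->
  exists M c t0 : R, [/\ 0 < M, 0 < c & forall t, t0 <= t ->
    exists s : seq T, [/\ uniq s, {in s, forall x, t < h x <= t + M} &
      c * (expR (a * t) * t ^+ b) <= (size s)%:R]].
Proof.
move=> a0 [c [t1 [c0 lo]]] [C [t2 [C0 up]]].
(* Then [expR (a * M) >= 1 + a * M >= C / c + 1], so at least [C + c] times the growth at [t] lies
   below [t + M]; discarding the points with [h <= t] costs at most [C] times that growth. *)
pose M := (C / c + 1) / a.
have M0 : 0 < M by rewrite divr_gt0// ltr_pwDr// divr_ge0// ltW.
exists M, c, (Num.max 0 (Num.max t1 t2)); split => // t.
rewrite !ge_max => /and3P[t_ge0 tt1 tt2].
have [|s [us sh ls]] := lo (t + M); first lra.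
have [s' hs' ls'] := up t tt2.
exists [seq x <- s | t < h x]; split; first exact: filter_uniq.
  by move=> x; rewrite mem_filter => /andP[-> /sh].
have sz : (size s <= size [seq x <- s | (t < h x)%R] + size s')%N.
  rewrite size_filter -(count_predC (fun x => t < h x) s) leq_add2l.
  rewrite -size_filter; apply: uniq_leq_size; first exact: filter_uniq.
  by move=> x; rewrite mem_filter /= -leNgt => /andP[/hs'].
move: sz; rewrite -(ler_nat R) natrD => sz.
have E0 : 0 <= expR (a * t) * t ^+ b by rewrite mulr_ge0 ?expR_ge0 ?exprn_ge0.
have step : (C + c) * (expR (a * t) * t ^+ b) <=
    c * (expR (a * (t + M)) * (t + M) ^+ b).
  have -> : C + c = c * (C / c + 1) by field; rewrite gt_eqF.
  rewrite -mulrA ler_pM2l// mulrA ler_pM//.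
  - by rewrite mulr_ge0 ?expR_ge0// addr_ge0// divr_ge0// ltW.
  - by rewrite exprn_ge0.
  - rewrite mulrDr expRD mulrC ler_pM2l ?expR_gt0//.
    apply: le_trans (expR_ge1Dx _).
    by rewrite /M mulrCA divff ?gt_eqF//; lra.
  by apply: lerXn2r; rewrite ?nnegrE; lra.
lra.
Qed.

(** Half-open shells are disjoint, so concatenated lists stay duplicate-free and their sizes add
    up. *)
Lemma pack_shells (R : realType) (T : eqType) (P : T -> Prop) (f : T -> R)
    (u : nat -> R) (r : R) (n : nat) :
  (forall j, u j <= u j.+1) ->
  (forall j, (j < n)%N -> exists s : seq T,
    [/\ uniq s, {in s, forall x, P x /\ u j < f x <= u j.+1} &
      r <= (size s)%:R]) ->
  exists s : seq T, [/\ uniq s, {in s, forall x, P x /\ f x <= u n} &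
      n%:R * r <= (size s)%:R].
Proof.
move=> uS; elim: n => [|n IH] hn.
  by exists [::]; split => //; rewrite mul0r.
have [|s [us sP ss]] := IH; first by move=> j jn; apply: hn; apply: ltnW.
have [s' [us' sP' ss']] := hn n (ltnSn n).
exists (s ++ s'); split.
- rewrite cat_uniq us us' andbT /=; apply/hasPn => x /sP'[_ /andP[ux _]].
  by apply/negP => /sP[_]; rewrite leNgt ux.
- move=> x; rewrite mem_cat => /orP[/sP[Px fx]|/sP'[Px /andP[_ fx]]] //.
  by split => //; apply: le_trans fx _.
by rewrite size_cat natrD -natr1 mulrDl mul1r lerD.
Qed.

Lemma log_lower_add_shift (R : realType) (S T : eqType) (h1 : S -> R)
    (h2 : T -> R) (a : R) (b : nat) (y : T) : log_lower h1 a b ->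
  log_lower (fun p => h1 p.1 + h2 p.2) a b.
Proof.
move=> [c [t0 [c0 lo]]].
(* The exponential pays for replacing [t] by [t - h2 y]; the power of 2 comes from
   [t - h2 y >= t / 2]. *)
exists (c * expR (- (a * h2 y)) * 2^-1 ^+ b),
  (Num.max 0 (Num.max (t0 + h2 y) (2 * h2 y))).
split; first by rewrite !mulr_gt0 ?exprn_gt0 ?expR_gt0 ?invr_gt0.
move=> t; rewrite !ge_max => /and3P[tp tt tt2].
have [|s [us sh ls]] := lo (t - h2 y); first lra.
exists [seq (x, y) | x <- s]; split.
- by rewrite map_inj_uniq// => x x' [].
- by move=> _ /mapP[x /sh hx ->] /=; lra.
rewrite size_map; apply: le_trans ls.
have -> : c * expR (- (a * h2 y)) * 2^-1 ^+ b * (expR (a * t) * t ^+ b) =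
    c * ((expR (- (a * h2 y)) * expR (a * t)) * (2^-1 ^+ b * t ^+ b)) by ring.
rewrite ler_pM2l// -expRD -exprMn_comm; last exact: mulrC.
have -> : - (a * h2 y) + a * t = a * (t - h2 y) by ring.
rewrite ler_pM2l ?expR_gt0//.
by apply: lerXn2r; rewrite ?nnegrE; lra.
Qed.

Lemma log_lower_add_eq (R : realType) (S T : eqType) (h1 : S -> R)
    (h2 : T -> R) (a : R) (b1 b2 : nat) : 0 < a ->
  log_lower h1 a b1 -> log_upper h1 a b1 -> log_lower h2 a b2 ->
  log_lower (fun p => h1 p.1 + h2 p.2) a (b1 + b2 + 1).
Proof.
move=> a0 lo1 up1 [c2 [t2 [c20 lo2]]].
have [M [c1 [t1 [M0 c10 sh1]]]] := log_lower_shell a0 lo1 up1.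
exists (c1 * c2 * expR (- (a * M)) / M * 6^-1 ^+ (b1 + b2 + 1)).
exists (6 * Num.max (Num.max t1 t2) M); split.
  by rewrite !mulr_gt0 ?exprn_gt0 ?expR_gt0 ?invr_gt0.
move=> t; rewrite -ler_pdivlMl//; set tau := 6^-1 * t.
rewrite !ge_max => /andP[/andP[tau1 tau2] tauM].
have te : t = 6 * tau by rewrite /tau mulrA divff ?mul1r.
(* The [n] shells start at [k = (n + j) * M] with [j < n], and [k + M <= 2 * n * M <= 4 * tau].
   Since [M <= tau], both [k] and [t - (k + M)] are at least [tau], and [n >= tau / M]. *)
pose n := Num.truncn (2 * tau / M).
have /andP[nle nlt] : n%:R * M <= 2 * tau < (n%:R + 1) * M.
  rewrite -ler_pdivlMr// -ltr_pdivrMr// natr1.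
  by apply: truncn_itv; rewrite divr_ge0//; lra.
pose r := c1 * c2 * expR (- (a * M)) * (expR (a * t) * tau ^+ (b1 + b2)).
have r0 : 0 <= r.
  by rewrite !mulr_ge0 ?expR_ge0 ?exprn_ge0 ?(ltW c10) ?(ltW c20)//; lra.
have [||s [us sP ss]] := @pack_shells R (S * T)%type
    (fun p => h1 p.1 + h2 p.2 <= t) (fun p => h1 p.1)
    (fun j => (n + j)%:R * M) r n.
- by move=> j; rewrite ler_wpM2r ?(ltW M0)// ler_nat leq_add2l.
- move=> j jn; have e : (n + j.+1)%:R * M = (n + j)%:R * M + M.
    by rewrite addnS -natr1 mulrDl mul1r.
  have nj : n%:R * M <= (n + j)%:R * M.
    by rewrite ler_wpM2r ?(ltW M0)// ler_nat leq_addr.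
  have njS : (n + j.+1)%:R * M <= 2 * (n%:R * M).
    rewrite mulrA ler_wpM2r ?(ltW M0)// -natrM ler_nat mul2n -addnn.
    by rewrite leq_add2l.
  set k := (n + j)%:R * M in e nj *.
  have [|sx [ux hx lx]] := sh1 k; first lra.
  have [|sy [uy hy ly]] := lo2 (t - (k + M)); first lra.
  exists [seq (x, y) | x <- sx, y <- sy]; split.
  + by apply: allpairs_uniq => // -[x y] [x' y'].
  + move=> _ /allpairsP[[x y] [/= /hx/andP[kx xk] /hy yt ->]] /=.
    by rewrite e kx xk; split => //; lra.
  rewrite size_allpairs natrM.
  apply: (@le_trans _ _ (c1 * (expR (a * k) * k ^+ b1) *
      (c2 * (expR (a * (t - (k + M))) * (t - (k + M)) ^+ b2)))); last first.
    by rewrite ler_pM// mulr_ge0 ?mulr_ge0 ?expR_ge0 ?exprn_ge0 ?ltW//; lra.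
  rewrite [leRHS](_ : _ = c1 * c2 * (expR (a * k) * expR (a * (t - (k + M))))
     * (k ^+ b1 * (t - (k + M)) ^+ b2)); last ring.
  (* With equal exponents [k] cancels, so every shell contributes at least the same [r]. *)
  rewrite -expRD (_ : _ + _ = - (a * M) + a * t); last ring.
  rewrite expRD /r exprD !mulrA.
  rewrite -[leLHS]mulrA -[leRHS]mulrA ler_wpM2l//.
    by rewrite !mulr_ge0 ?expR_ge0// ltW.
  rewrite ler_pM ?exprn_ge0//; try lra.
    by apply: lerXn2r; rewrite ?nnegrE; lra.
  by apply: lerXn2r; rewrite ?nnegrE; lra.
exists s; split => //; first by move=> x /sP[].
apply: le_trans ss.
have -> : c1 * c2 * expR (- (a * M)) / M * 6^-1 ^+ (b1 + b2 + 1) *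
   (expR (a * t) * t ^+ (b1 + b2 + 1)) = tau / M * r.
  rewrite /r /tau !exprMn addn1 !exprS; ring.
by rewrite ler_wpM2r// ler_pdivrMr//; lra.
Qed.

(** * Upper bounds for sums of log-heights *)

Lemma cover_shells (T : eqType) (R : realType) (A : nat -> T -> Prop)
    (r : nat -> R) (n : nat) :
  (forall k, (k < n)%N -> exists2 s : seq T,
    forall x, A k x -> x \in s & (size s)%:R <= r k) ->
  exists2 s : seq T, forall k x, (k < n)%N -> A k x -> x \in s &
    (size s)%:R <= \sum_(k < n) r k.
Proof.
elim: n => [|n IH] hn; first by exists [::]; rewrite ?big_ord0.
have [|s hs ss] := IH; first by move=> k kn; apply: hn; apply: ltnW.
have [s' hs' ss'] := hn n (ltnSn n).
exists (s ++ s') => [k x|]; last by rewrite size_cat natrD big_ord_recr lerD.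
rewrite ltnS leq_eqVlt mem_cat => /orP[/eqP->/hs'->|kn /(hs _ _ kn)->//].
by rewrite orbT.
Qed.

(** The factor of degree [b1] is replaced by its largest value, while that of degree [b2] keeps its
    dependence on [k]: when [a2 < a1] it must be absorbed by exponential decay in [t + m - k]. *)
Lemma cover_add (R : realType) (S T : eqType) (h1 : S -> R) (h2 : T -> R)
    (a1 a2 : R) (b1 b2 : nat) : 0 <= a1 -> 0 <= a2 ->
  log_upper h1 a1 b1 -> log_upper h2 a2 b2 ->
  exists m C : R, [/\ 0 <= m, 0 < C & forall t, 0 <= t + m ->
    exists2 s : seq (S * T), forall p, h1 p.1 + h2 p.2 <= t -> p \in s &
      (size s)%:R <= C * \sum_(k < (Num.truncn (t + m)).+1)
        expR (a1 * k%:R + a2 * (t + m - k%:R)) *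
        ((t + m + 2) ^+ b1 * (1 + (t + m - k%:R)) ^+ b2)].
Proof.
move=> a10 a20 /(log_upper_uniform a10)[m1 [C1 [m10 C10 hm1 up1]]].
move=> /(log_upper_uniform a20)[m2 [C2 [m20 C20 hm2 up2]]].
(* The factor [expR a1] comes from counting up to the upper end [k + 1] of the shell. *)
exists (m1 + m2), (C1 * expR a1 * C2); split.
- exact: addr_ge0.
- by rewrite !mulr_gt0 ?expR_gt0.
move=> T0; set t := T0 + (m1 + m2) => t0.
have [] := @cover_shells (S * T)%type R
  (fun k p => h1 p.1 <= k.+1%:R - m1 /\ h2 p.2 <= t - k%:R - m2)
  (fun k => C1 * expR a1 * C2 * (expR (a1 * k%:R + a2 * (t - k%:R)) *
        ((t + 2) ^+ b1 * (1 + (t - k%:R)) ^+ b2))) (Num.truncn t).+1.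
  move=> k kn.
  have kt : k%:R <= t by rewrite -truncn_ge_nat.
  have [|s1 hs1 ss1] := up1 k.+1%:R; first exact: ler0n.
  have [|s2 hs2 ss2] := up2 (t - k%:R); first by rewrite subr_ge0.
  exists [seq (x, y) | x <- s1, y <- s2].
    move=> [x y] /= [/hs1 xs /hs2 ys].
    by apply/allpairsP; exists (x, y).
  rewrite size_allpairs natrM; apply: (le_trans (ler_pM _ _ ss1 ss2)) => //.
  rewrite expRD -natr1 mulrDr mulr1 expRD.
  have : (1 + (k%:R + 1)) ^+ b1 <= (t + 2) ^+ b1.
    have k0 : 0 <= k%:R :> R by exact: ler0n.
    by apply: lerXn2r; rewrite ?nnegrE; lra.
  rewrite -subr_ge0 => h; rewrite -subr_ge0.
  set E1 := expR _; set E2 := expR _; set E3 := expR _.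
  set p1 := (1 + _) ^+ b1; set q := _ ^+ b2.
  rewrite (_ : _ - _ = C1 * E2 * C2 * E1 * E3 * q * ((t + 2) ^+ b1 - p1));
    last by rewrite /E1 /E2 /E3; ring.
  have q0 : 0 <= q by rewrite exprn_ge0//; lra.
  by rewrite !mulr_ge0 ?expR_ge0 ?(ltW C10) ?(ltW C20).
move=> s hs ss; exists s; last by rewrite mulr_sumr.
move=> [x y] /= hxy.
have x0 := hm1 x; have y0 := hm2 y.
have u0 : 0 <= h1 x + m1 by lra.
have /andP[k1 k2] := truncn_itv u0.
apply: (hs (Num.truncn (h1 x + m1))).
  by rewrite ltnS truncn_ge_nat// /t; lra.
by move: k1 k2; rewrite /t /=; lra.
Qed.

Lemma log_upper_of_shift (R : realType) (T : eqType) (h : T -> R)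
    (a m C : R) (b : nat) : 0 <= m -> 0 < C ->
  (forall t, 0 <= t + m -> exists2 s : seq T, forall x, h x <= t -> x \in s &
    (size s)%:R <= C * (expR (a * (t + m)) * (t + m + 2) ^+ b)) ->
  log_upper h a b.
Proof.
move=> m0 C0 up; exists (C * expR (a * m) * 2 ^+ b), (m + 2); split.
  by rewrite !mulr_gt0 ?expR_gt0 ?exprn_gt0.
move=> t mt; have [|s hs ss] := up t; first lra.
exists s => //; apply: (le_trans ss).
have -> : C * expR (a * m) * 2 ^+ b * (expR (a * t) * t ^+ b) =
    C * (expR (a * t) * expR (a * m) * (2 ^+ b * t ^+ b)) by ring.
rewrite mulrDr -expRD -exprMn_comm; last exact: mulrC.
rewrite ler_pM2l// ler_pM2l ?expR_gt0//.
by apply: lerXn2r; rewrite ?nnegrE; lra.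
Qed.

Lemma log_upper_add_eq (R : realType) (S T : eqType) (h1 : S -> R)
    (h2 : T -> R) (a : R) (b1 b2 : nat) : 0 <= a ->
  log_upper h1 a b1 -> log_upper h2 a b2 ->
  log_upper (fun p => h1 p.1 + h2 p.2) a (b1 + b2 + 1).
Proof.
move=> a0 up1 up2.
have [m [C [m0 C0 up]]] := cover_add a0 a0 up1 up2.
apply: (log_upper_of_shift m0 C0) => t0 tm0.
have [s hs ss] := up t0 tm0; exists s => //; apply: (le_trans ss).
rewrite ler_pM2l//; set t := t0 + m in tm0 *.
have /andP[k1 k2] := truncn_itv tm0.
pose r := expR (a * t) * (t + 2) ^+ (b1 + b2).
have r0 : 0 <= r by rewrite mulr_ge0 ?expR_ge0 ?exprn_ge0//; lra.
apply: (@le_trans _ _ (\sum_(k < (Num.truncn t).+1) r)).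
  apply: ler_sum => k _; rewrite -mulrDr addrC subrK ler_pM2l ?expR_gt0// exprD.
  have k0 : 0 <= k%:R :> R by exact: ler0n.
  have kt : k%:R <= t by rewrite -truncn_ge_nat// -ltnS.
  rewrite ler_wpM2l ?exprn_ge0//; first lra.
  by apply: lerXn2r; rewrite ?nnegrE; lra.
(* The number of terms, at most [t + 1], supplies the extra power. *)
rewrite sumr_const card_ord -[leLHS]mulr_natl addn1 exprS [leRHS]mulrCA ler_wpM2r//.
by rewrite -natr1; lra.
Qed.

(** Raise [1 + x <= (1 + eta^-1) * (1 + eta * x) <= (1 + eta^-1) * expR (eta * x)] to the power [b],
    with [eta * b <= e]. Dividing by [b.+1] also allows [b = 0]. *)
Lemma expr_le_expR (R : realType) (e : R) (b : nat) : 0 < e ->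
  exists2 K : R, 0 < K & forall x, 0 <= x -> (1 + x) ^+ b <= K * expR (e * x).
Proof.
move=> e0; pose eta := e / b.+1%:R.
have eta0 : 0 < eta by rewrite divr_gt0.
exists ((1 + eta^-1) ^+ b).
  by rewrite exprn_gt0// addr_gt0// invr_gt0.
move=> x x0; apply: (@le_trans _ _ (((1 + eta^-1) * expR (eta * x)) ^+ b)).
  have i0 : 0 < eta^-1 by rewrite invr_gt0.
  apply: lerXn2r; rewrite ?nnegrE.
  - by rewrite addr_ge0.
  - by rewrite mulr_ge0 ?expR_ge0//; lra.
  apply: (@le_trans _ _ ((1 + eta^-1) * (1 + eta * x))).
    have : 0 <= eta * x by rewrite mulr_ge0// ltW.
    by rewrite mulrDl mul1r mulrDr mulr1 mulKf ?gt_eqF//; lra.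
  by rewrite ler_pM2l ?expR_ge1Dx//; lra.
rewrite exprMn_comm; last exact: mulrC.
rewrite ler_pM2l ?exprn_gt0 ?addr_gt0 ?invr_gt0//.
rewrite -expRM_natl ler_expR mulrA ler_wpM2r// /eta mulrCA ler_piMr ?(ltW e0)//.
by rewrite ler_pdivrMr// mul1r ler_nat.
Qed.

Lemma geometric_expR_le (R : realType) (e : R) (n : nat) : 0 < e ->
  \sum_(k < n.+1) expR (e * k%:R) <= (1 - expR (- e))^-1 * expR (e * n%:R).
Proof.
move=> e0; set A := _^-1.
have q1 : 0 < 1 - expR (- e) by rewrite subr_gt0 expR_lt1 oppr_lt0.
(* This fixed-point equation is what closes the induction. *)
have AE : A = A * expR (- e) + 1.
  by rewrite -[X in _ + X](mulVf (lt0r_neq0 q1)) -/A; ring.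
elim: n => [|n IH].
  rewrite big_ord1 mulr0 expR0 mulr1 AE lerDr mulr_ge0 ?expR_ge0//.
  by rewrite invr_ge0 ltW.
rewrite big_ord_recr /=; apply: (le_trans (lerD IH (lexx _))).
rewrite [in leRHS]AE mulrDl mul1r lerD2r -mulrA -expRD.
by rewrite -natr1 (_ : - e + _ = e * n%:R)//; ring.
Qed.

Lemma log_upper_add_lt (R : realType) (S T : eqType) (h1 : S -> R)
    (h2 : T -> R) (a1 a2 : R) (b1 b2 : nat) : 0 <= a2 -> a2 < a1 ->
  log_upper h1 a1 b1 -> log_upper h2 a2 b2 ->
  log_upper (fun p => h1 p.1 + h2 p.2) a1 b1.
Proof.
move=> a20 a21 up1 up2.
have a10 : 0 <= a1 by lra.
have [m [C [m0 C0 up]]] := cover_add a10 a20 up1 up2.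
(* Half of the exponent gap absorbs the factor of degree [b2]; the other half leaves a geometric
   series in [k], dominated by its last term [n <= t]. *)
pose e := (a1 - a2) / 2; have e0 : 0 < e by rewrite /e; lra.
have [K K0 hK] := expr_le_expR b2 e0.
pose A := (1 - expR (- e))^-1.
have A0 : 0 < A by rewrite invr_gt0 subr_gt0 expR_lt1 oppr_lt0.
apply: (@log_upper_of_shift _ _ _ _ m (C * (K * A))) => //.
  by rewrite !mulr_gt0.
move=> t0 tm0; have [s hs ss] := up t0 tm0; exists s => //.
apply: (le_trans ss); rewrite -mulrA ler_pM2l//; set t := t0 + m in tm0 *.
have /andP[n1 n2] := truncn_itv tm0; set n := Num.truncn t in n1 n2 *.
pose r := K * (expR (a1 * t) * (t + 2) ^+ b1) * expR (- (e * t)).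
have r0 : 0 <= r.
  by rewrite !mulr_ge0 ?expR_ge0 ?exprn_ge0 ?(ltW K0)//; lra.
apply: (@le_trans _ _ (\sum_(k < n.+1) r * expR (e * k%:R))).
  apply: ler_sum => k _.
  have kt : k%:R <= t by rewrite -truncn_ge_nat// -ltnS.
  have := hK (t - k%:R); rewrite subr_ge0 => /(_ kt) hk.
  have -> : r * expR (e * k%:R) =
      expR (a1 * k%:R + a2 * (t - k%:R)) *
        ((t + 2) ^+ b1 * (K * expR (e * (t - k%:R)))).
    have key : expR (a1 * t) * expR (- (e * t)) * expR (e * k%:R) =
        expR (a1 * k%:R + a2 * (t - k%:R)) * expR (e * (t - k%:R)).
      by rewrite -!expRD; congr expR; rewrite /e; field.
    transitivity (K * (t + 2) ^+ b1 *
      (expR (a1 * t) * expR (- (e * t)) * expR (e * k%:R))).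
      by rewrite /r; ring.
    by rewrite key; ring.
  rewrite ler_wpM2l ?expR_ge0// ler_wpM2l ?exprn_ge0//; lra.
rewrite -mulr_sumr.
apply: (le_trans (ler_wpM2l r0 (geometric_expR_le n e0))); rewrite -/A.
have -> : r * (A * expR (e * n%:R)) = K * A * (expR (a1 * t) * (t + 2) ^+ b1) *
    (expR (- (e * t)) * expR (e * n%:R)) by rewrite /r; ring.
rewrite -expRD ler_piMr//.
  by rewrite !mulr_ge0 ?expR_ge0 ?exprn_ge0 ?(ltW K0) ?(ltW A0)//; lra.
by rewrite -[leRHS]expR0 ler_expR addrC subr_le0 ler_pM2l.
Qed.

(** * From sums of log-heights back to the product height *)

Theorem theoremC3 (R : realType) (X Y : countType) (H1 : X -> R) (H2 : Y -> R)
    (H1_gt0 : forall x, 0 < H1 x) (H2_gt0 : forall y, 0 < H2 y)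
    (alpha1 alpha2 : R) (beta1 beta2 : nat)
    (alpha2_gt0 : 0 < alpha2) (alpha21 : alpha2 <= alpha1)
    (NX : asymp (height_count H1) (pow_log alpha1 beta1))
    (NY : asymp (height_count H2) (pow_log alpha2 beta2)) :
  let: (alpha, beta) :=
    if alpha2 < alpha1 then (alpha1, beta1)
    else (alpha1, (beta1 + beta2 + 1)%N) in
  asymp (height_count (prod_height H1 H2)) (pow_log alpha beta).
Proof.
have [lo1 up1] := (asymp_pow_logP alpha1 beta1 H1_gt0).1 NX.
have [lo2 up2] := (asymp_pow_logP alpha2 beta2 H2_gt0).1 NY.
have H_gt0 p : 0 < prod_height H1 H2 p by exact: mulr_gt0.
have lnH : (fun p => ln (prod_height H1 H2 p)) =
    (fun p => ln (H1 p.1) + ln (H2 p.2)).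
  by apply/funext => p; rewrite lnM ?posrE.
have [lt21|ge21] := ltP alpha2 alpha1.
  apply/(asymp_pow_logP _ _ H_gt0); rewrite lnH; split.
    have [y _] := log_lower_inhabited lo2.
    exact: (log_lower_add_shift (fun y => ln (H2 y)) y lo1).
  exact: log_upper_add_lt (ltW alpha2_gt0) lt21 up1 up2.
have e21 : alpha2 = alpha1 by apply/eqP; rewrite eq_le alpha21.
rewrite {}e21 in alpha2_gt0 lo2 up2.
apply/(asymp_pow_logP _ _ H_gt0); rewrite lnH; split.
  exact: (log_lower_add_eq alpha2_gt0 lo1 up1 lo2).
exact: log_upper_add_eq (ltW alpha2_gt0) up1 up2.
Qed.
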